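(* There exists a nonzero positive discrete translation bounded almost periodic measure $\mu$ on $\mathbb{R}$ such that $$\mu(\lambda)\to 0\quad\text{as}\quad \lambda\to\infty,\ \lambda\in\operatorname{supp}\mu,$$ i.e. for every $\varepsilon>0$ there is $R>0$ such that $\mu(\lambda)<\varepsilon$ for all $\lambda\in\operatorname{supp}\mu$ with $|\lambda|>R$.
   Context: $C_u(\mathbb{R})$ is the space of uniformly continuous bounded complex functions on $\mathbb{R}$ with the sup-norm, and $C_c(\mathbb{R})$ is its subspace of compactly supported continuous functions. Measures are Radon measures on $\mathbb{R}$ (finite on compact sets, not necessarily of finite total mass). A measure $\mu$ with support $\Lambda$ is discrete if each $\lambda\in\Lambda$ has a neighborhood $\lambda+U$ with $(\lambda+U)\cap\Lambda=\{\lambda\}$; then $\mu=\sum_{\lambda\in\Lambda}\mu(\lambda)\delta_\lambda$, where $\delta_\lambda$ is the unit mass at $\lambda$ and $\mu(\lambda)$ is the mass at $\lambda$. $\mu$ is translation bounded if $\sup_{t\in\mathbb{R}}|\mu|(K+t)<\infty$ for every compact $K\subset\mathbb{R}$, where $|\mu|$ is the variation of $\mu$. A function $g\in C_u(\mathbb{R})$ is almost periodic if the closure of the family of translates $\{g(\cdot-t)\}_{t\in\mathbb{R}}$ is a compact subset of $C_u(\mathbb{R})$. A Radon measure $\mu$ on $\mathbb{R}$ is almost periodic if for each $f\in C_c(\mathbb{R})$ the function $(f\star\mu)(x)=\int f(x-y)\,d\mu(y)$ is almost periodic on $\mathbb{R}$. *)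

(* Defs.v *)
From HB Require Import structures.
From mathcomp Require Import all_boot all_order all_algebra.
From mathcomp Require Import complex.
From mathcomp Require Import all_classical all_reals all_analysis.

Set Implicit Arguments.
Unset Strict Implicit.
Unset Printing Implicit Defensive.

Import Order.TTheory GRing.Theory Num.Theory.
Import numFieldNormedType.Exports.

Local Open Scope classical_set_scope.
Local Open Scope ring_scope.
Local Open Scope complex_scope.

(* R[i] gets the norm and topology that every numFieldType carries. *)
HB.instance Definition _ (R : realType) :=
  NormedModule.copy R[i] ((R[i] : numFieldType)^o).

Section functions.
Context {R : realType}.

Definition Cc : set (R -> R[i]) :=
  [set f | continuous f /\ compact (closure [set x | f x != 0])].

(* C_u(R), as a subset of the space of all functions R -> R[i] with the
   topology of uniform convergence: on C_u(R) this is the topology of the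
   sup-norm. *)
Definition Cu : set {uniform R -> R[i]} :=
  [set g : R -> R[i] | unif_continuous g /\ bounded_fun g].

Definition translates (g : R -> R[i]) : set {uniform R -> R[i]} :=
  range (fun t : R => (fun x : R => g (x - t)) : {uniform R -> R[i]}).

(* [closure (translates g) `&` Cu] is the closure of the translates relative
   to C_u(R). *)
Definition almost_periodic (g : R -> R[i]) : Prop :=
  Cu g /\ compact (closure (translates g) `&` Cu).

End functions.

Section measures.
Context {R : realType}.
Implicit Type mu : {measure set R -> \bar R}.

(* Regularity is automatic: every Borel measure on R that is finite on compact
   sets is regular. *)
Definition radon mu : Prop :=
  forall K : set R, compact K -> (mu K < +oo)%E.

(* [mu A] carries no information when [A] is not Borel, so that [mu <> mzero]
   would be too weak. *)
Definition nonzero_measure mu : Prop :=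
  exists2 A : set R, measurable A & mu A != 0%E.

Definition msupport mu : set R :=
  [set x | forall U : set R, open_nbhs x U -> (0 < mu U)%E].

Definition discrete_measure mu : Prop :=
  msupport mu `<=` isolated (msupport mu).

Definition measure_variation (nu : set R -> \bar R) (A : set R) : \bar R :=
  ereal_sup [set s | exists (n : nat) (F : 'I_n -> set R),
    [/\ forall i, measurable (F i), trivIset [set: 'I_n] F,
        \bigcup_i F i = A & s = (\sum_(i < n) `|nu (F i)|)%E]].

Definition translation_bounded mu : Prop :=
  forall K : set R, compact K ->
    (ereal_sup [set measure_variation mu [set (x + t)%R | x in K] | t in [set: R]]
       < +oo)%E.

Definition convolution (f : R -> R[i]) mu (x : R) : R[i] :=
  (\int[mu]_y complex.Re (f (x - y))) +i* (\int[mu]_y complex.Im (f (x - y))).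

Definition almost_periodic_measure mu : Prop :=
  forall f : R -> R[i], Cc f -> almost_periodic (convolution f mu).

End measures.

(* Main.v *)
Require Import Defs.
From mathcomp Require Import all_boot all_order all_algebra.
From mathcomp Require Import complex.
From mathcomp Require Import all_classical all_reals all_analysis.
From mathcomp Require Import measurable_realfun.
From mathcomp Require Import zify lra ring.

(** The masses of an almost periodic measure on the integers cannot decay, and
    cutting every unit mass into finer and finer equal pieces of one interval
    does not help either: the pieces would converge to a continuous density, so
    that the convolutions would be asymptotically periodic without being almost
    periodic.  The cure is to choose the scales of the cuts by an almost
    periodic rule.

    Let the mass of [n, n+1), for an integer n, be the law of the random point
    n + sum_(k in S n) eps_k / 2^k, where the eps_k are independent fair bits
    and S n is the set of the levels k >= 1 such that the distance from n to
    the multiples of 2^k is at least k.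

    - Membership of k in S n depends on n modulo 2^k only.  A translation by a
      multiple of 2^K therefore changes S n above level K only, and moves the
      random points by at most 2^-K: the convolution of the measure with a
      uniformly continuous compactly supported function changes little, and it
      is almost periodic (bohr_convolution, bohr_almost_periodic).
    - S n is finite, as the distance is at most |n| < k for large k; so the
      mass of [n, n+1) sits on finitely many atoms (rounding_finite).
    - The levels k close to |n| all belong to S n when |n| is large
      (size_levels), and binary expansions are unique: the 2^#|S n| atoms are
      distinct, and their common mass 2^-#|S n| tends to 0 (rounding_inj).

    The measure is realised as the image of Lebesgue measure under a map,
    rounding, that moves no point by more than 1: the i-th binary digit of the
    fractional part of y serves as eps_k for the i-th element k of S n, where n
    is the floor of y.  All properties of the measure become properties of that
    map: radon and translation bounded because points move by at most 1,
    discrete because bounded sets have finite images, with small atoms because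
    fibres have small diameter, almost periodic because the map almost commutes
    with the translations by multiples of 2^K.  Translation invariance of
    Lebesgue measure gives the last point (convolution_almost_period). *)

Import Order.TTheory GRing.Theory Num.Theory.
Import numFieldNormedType.Exports.

Local Open Scope classical_set_scope.
Local Open Scope ring_scope.

(** * Binary expansions with prescribed digit positions *)

Section spreading.
Context {R : realType}.
Implicit Types (s : seq nat) (u v : R).

(** The digits of [u] in [0, 1) become the digits at the positions listed in
    [s]: the first element of [s] receives the leading digit of [u], and the
    next ones the digits of the fractional part of [2 * u].  Consuming the
    digits of [u] in order makes the fibres of [spread s] intervals. *)
Fixpoint spread s u : R :=
  if s is k :: s' then
    if 2^-1 <= u then 2 ^- k + spread s' (2 * u - 1) else spread s' (2 * u)
  else 0.

Lemma spread_ge0 s u : 0 <= spread s u.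
Proof.
elim: s u => //= k s IH u; case: ifP => _ //.
by rewrite addr_ge0// invr_ge0 exprn_ge0.
Qed.

Lemma half_power_double m : 2 ^- m.+1 + 2 ^- m.+1 = 2 ^- m :> R.
Proof. by rewrite exprS invfM; lra. Qed.

Lemma half_power_anti m k : (m <= k)%N -> 2 ^- k <= 2 ^- m :> R.
Proof.
move=> mk; rewrite lef_pV2 ?posrE ?exprn_gt0//.
by rewrite ler_weXn2l// ler1n.
Qed.

(** The positions are beyond [m], so the digits sum to less than the geometric
    tail from [m.+1] on. *)
Lemma spread_lt m s u : path ltn m s -> spread s u < 2 ^- m.
Proof.
elim: s m u => [|k s IH] m u /=; first by rewrite invr_gt0 exprn_gt0.
case/andP => mk ks; have := half_power_double k.-1.
rewrite (ltn_predK mk) => dbl.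
have : 2 ^- k.-1 <= 2 ^- m :> R by apply: half_power_anti; lia.
have k0 : 0 < 2 ^- k :> R by rewrite invr_gt0 exprn_gt0.
have := IH k (2 * u - 1) ks; have := IH k (2 * u) ks.
by case: ifP => _; lra.
Qed.

(** The digits used for [s1] are the same whether or not [s2] follows, since
    they are the leading ones. *)
Lemma spread_cat m s1 s2 u : path ltn m s2 ->
  spread s1 u <= spread (s1 ++ s2) u < spread s1 u + 2 ^- m.
Proof.
move=> ms; elim: s1 u => [|k s IH] u /=.
  by rewrite spread_ge0 add0r spread_lt.
case: ifP => _; last exact: IH.
by rewrite lerD2l -addrA ltrD2l; exact: IH.
Qed.

(** Uniqueness of finite binary expansions: if the leading digits of [u] and
    [v] differ, [spread_lt] keeps the later positions from compensating the
    difference, and otherwise the digits are compared one position further. *)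
Lemma spread_inj m s u v : path ltn m s -> 0 <= u < 1 -> 0 <= v < 1 ->
  spread s u = spread s v -> `|u - v| <= 2 ^- size s.
Proof.
elim: s m u v => [|k s IH] m u v /=.
  by move=> _ ? ? _; rewrite expr0 invr1 ler_norml; lra.
case/andP => _ ks u01 v01.
have dbl := half_power_double (size s).
have := IH k _ _ ks; have := spread_lt _ _ _ ks; have := spread_ge0 s.
move=> s0 s1 {}IH; case: ifPn => hu; case: ifPn => hv.
- move=> /addrI /IH; rewrite !ler_norml => IH'.
  by have := IH' ltac:(lra) ltac:(lra); lra.
- by have := s0 (2 * u - 1); have := s1 (2 * v); lra.
- by have := s0 (2 * v - 1); have := s1 (2 * u); lra.
- move=> /IH; rewrite !ler_norml => IH'.
  by have := IH' ltac:(lra) ltac:(lra); lra.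
Qed.

Lemma spread_finite s : finite_set (range (spread s)).
Proof.
elim: s => [|k s IH].
  apply: (@sub_finite_set _ _ [set 0]); last exact: finite_set1.
  by move=> _ [u _ <-].
apply: (@sub_finite_set _ _
  (range (spread s) `|` (fun w : R => 2 ^- k + w) @` range (spread s))).
  move=> _ [u _ <-] /=; case: ifP => _; [right|left].
    by exists (spread s (2 * u - 1)) => //; exists (2 * u - 1).
  by exists (2 * u).
by rewrite finite_setU; split => //; exact: finite_image.
Qed.

Lemma measurable_spread s : measurable_fun [set: R] (spread s).
Proof.
elim: s => [|k s IH] /=; first exact: measurable_cst.
have m2 : measurable_fun [set: R] (fun u : R => 2 * u).
  by apply: measurable_funM => //; exact: measurable_cst.
apply: measurable_fun_ifT.
- by apply: measurable_fun_ler => //; exact: measurable_cst.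
- apply: measurable_funD; first exact: measurable_cst.
  apply: (measurableT_comp IH); apply: measurable_funB => //.
- exact: (measurableT_comp IH).
Qed.

End spreading.

(** * The levels at which the mass at an integer is split *)

Section levels.
Implicit Types (n m : int) (k K : nat).

(** The distance from [n] to the multiples of [2 ^ k] is at least [k]. *)
Definition splits k n : bool :=
  let r := (n %% 2 ^+ k)%Z in (k%:Z <= r) && (r + k%:Z <= 2 ^+ k).

Definition levels_below M n : seq nat := [seq k <- iota 1 M | splits k n].

(** No level beyond [`|n|] splits [n], by [splits_oversize]. *)
Definition levels n : seq nat := levels_below `|n| n.

Lemma splits_periodic k K n m : (k <= K)%N ->
  splits k (n + m * 2 ^+ K) = splits k n.
Proof.
move=> kK; rewrite /splits -(subnK kK) exprD mulrA.
by rewrite addrC modzMDl.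
Qed.

Lemma residue_small k n : (`|n| < 2 ^ k)%N ->
  (n %% 2 ^+ k)%Z = if 0 <= n then n else n + 2 ^+ k.
Proof.
move=> nk; have -> : 2 ^+ k = (2 ^ k)%N%:Z :> int by rewrite -natrX; lia.
case: ifP => n0; first by rewrite modz_small//; lia.
by rewrite -modzDr modz_small//; lia.
Qed.

(** 0 is a multiple of [2 ^ k] at distance less than [k] from [n]. *)
Lemma splits_oversize k n : (`|n| < k)%N -> splits k n = false.
Proof.
move=> nk; have k2 : (k < 2 ^ k)%N by rewrite ltn_expl.
rewrite /splits residue_small; last lia.
have -> : 2 ^+ k = (2 ^ k)%N%:Z :> int by rewrite -natrX; lia.
by case: ifP => n0; apply/negbTE; lia.
Qed.

Lemma levels_extend M n : (`|n| <= M)%N -> levels n = levels_below M n.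
Proof.
move=> nM; rewrite /levels /levels_below -(subnKC nM) iotaD filter_cat.
rewrite -[LHS]cats0; congr (_ ++ _); apply/esym/eqP.
rewrite -[_ == _]negbK -has_filter; apply/hasPn => k.
by rewrite mem_iota => kn; rewrite splits_oversize//; lia.
Qed.

Lemma levels_split K n :
  exists2 s, path ltn K s & levels n = levels_below K n ++ s.
Proof.
exists [seq k <- iota K.+1 `|n| | splits k n].
  apply: (subseq_path ltn_trans (filter_subseq _ _)).
  exact: (iota_ltn_sorted K `|n|.+1).
rewrite (@levels_extend (K + `|n|)) ?leq_addl//.
by rewrite /levels_below iotaD filter_cat.
Qed.

Lemma levels_below_periodic K n m :
  levels_below K (n + m * 2 ^+ K) = levels_below K n.
Proof.
apply: eq_in_filter => k; rewrite mem_iota => kK.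
by rewrite splits_periodic//; lia.
Qed.

Lemma sorted_levels n : path ltn 0 (levels n).
Proof. by have [s ps ->] := levels_split 0 n. Qed.

Lemma three_mul_le_exp2 k : (4 <= k)%N -> (3 * k <= 2 ^ k)%N.
Proof.
elim: k => // k IH; rewrite leq_eqVlt => /predU1P[[<-]//|k4].
by rewrite expnS; have := IH k4; lia.
Qed.

(** The last [N] integers [k] up to [`|n|] all split [n]: each satisfies
    [`|n| <= 2 * k], hence [`|n| + k <= 3 * k <= 2 ^ k], so that [n] is at
    distance at least [k] from 0 and from the other multiples of [2 ^ k]. *)
Lemma size_levels N n : (2 * N + 8 <= `|n|)%N -> (N <= size (levels n))%N.
Proof.
move=> Nn; rewrite /levels /levels_below.
have -> : `|n|%N = ((`|n| - N) + N)%N by lia.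
rewrite iotaD filter_cat size_cat addnC; apply: (leq_trans _ (leq_addr _ _)).
rewrite (_ : [seq _ <- _ | _] = iota (1 + (`|n| - N)) N) ?size_iota//.
apply/all_filterP/allP => k; rewrite mem_iota => kn.
have k3 : (3 * k <= 2 ^ k)%N by apply: three_mul_le_exp2; lia.
rewrite /splits residue_small; last lia.
have -> : 2 ^+ k = (2 ^ k)%N%:Z :> int by rewrite -natrX; lia.
by case: ifP => n0; lia.
Qed.

End levels.

(** * The rounding map *)

Section rounding.
Context {R : realType}.
Implicit Types (x y : R).

Definition rounding y : R :=
  (Num.floor y)%:~R + spread (levels (Num.floor y)) (y - (Num.floor y)%:~R).

Lemma frac_itv y : 0 <= y - (Num.floor y)%:~R < 1.
Proof. by have := floor_itv y; rewrite intrD1; lra. Qed.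

Lemma rounding_itv y :
  (Num.floor y)%:~R <= rounding y < (Num.floor y)%:~R + 1.
Proof.
rewrite /rounding lerDl ltrD2l spread_ge0/=.
by rewrite -[1](expr0 2^-1) exprVn spread_lt// sorted_levels.
Qed.

Lemma floor_rounding y : Num.floor (rounding y) = Num.floor y.
Proof. by apply: floor_def; rewrite intrD1 rounding_itv. Qed.

Lemma rounding_near y : `|rounding y - y| <= 1.
Proof.
by rewrite ler_norml; have := rounding_itv y; have := frac_itv y; lra.
Qed.

(** The floor survives rounding, so points with the same rounding also have the
    same levels, and [spread_inj] applies. *)
Lemma rounding_inj N y y' : (2 * N + 8 <= `|Num.floor y|)%N ->
  rounding y = rounding y' -> `|y - y'| <= 2 ^- N.
Proof.
move=> Ny yy'; have fyy' : Num.floor y = Num.floor y'.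
  by rewrite -floor_rounding yy' floor_rounding.
move: yy'; rewrite /rounding -fyy' => /addrI yy'.
apply: (le_trans _ (half_power_anti _ _ (size_levels _ _ Ny))).
have fy' := frac_itv y'; rewrite -fyy' in fy'.
have := spread_inj _ _ _ _ (sorted_levels _) (frac_itv y) fy' yy'.
by rewrite opprD addrACA opprK addNr addr0.
Qed.

(** Points that differ by a multiple of [2 ^ K] have the same levels up to
    [K], and both roundings stay within [2 ^- K] above the sum of the common
    digits. *)
Lemma rounding_quasiperiodic K (m : int) y :
  `|rounding (y + m%:~R * 2 ^+ K) - (rounding y + m%:~R * 2 ^+ K)| <= 2 ^- K.
Proof.
set p := m%:~R * 2 ^+ K.
have pE : p = (m * 2 ^+ K)%:~R by rewrite intrM rmorphXn.
have fE : Num.floor (y + p) = Num.floor y + m * 2 ^+ K.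
  by rewrite pE floorDrz ?intr_int// intrKfloor.
rewrite /rounding fE intrD -pE.
have -> : y + p - ((Num.floor y)%:~R + p) = y - (Num.floor y)%:~R by lra.
have [s1 ps1 ->] := levels_split K (Num.floor y + m * 2 ^+ K).
have [s2 ps2 ->] := levels_split K (Num.floor y).
rewrite levels_below_periodic.
set s := levels_below K _; set u := y - _.
have := spread_cat _ s _ u ps1; have := spread_cat _ s _ u ps2.
by rewrite ler_norml; lra.
Qed.

Lemma rounding_finite M : finite_set (rounding @` `[- M, M]).
Proof.
pose N := `|Num.ceil M|%N.+1.
pose F (i : nat) : set R :=
  (fun w : R => (i%:Z - N%:Z)%:~R + w) @` range (spread (levels (i%:Z - N%:Z))).
apply: (@sub_finite_set _ _ (\bigcup_(i in `I_(N + N)) F i)); last first.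
  by apply: bigcup_finite => // i _; apply/finite_image/spread_finite.
move=> _ [y + <-]; rewrite /= in_itv/= => yM.
have fN : - N%:Z <= Num.floor y < N%:Z.
  have : M <= (Num.ceil M)%:~R by exact: ceil_ge.
  have : (Num.ceil M)%:~R <= `|Num.ceil M|%N%:~R :> R by rewrite ler_int; lia.
  move=> h1 h2; rewrite floor_ge_int floor_lt_int /N -addn1.
  by rewrite PoszD rmorphN/= intrD; lra.
exists (absz (Num.floor y + N%:Z)) => /=; first by lia.
rewrite /F.
have -> : (absz (Num.floor y + N%:Z))%:Z - N%:Z = Num.floor y by lia.
by eexists; last reflexivity; eexists.
Qed.

Lemma measurable_rounding : measurable_fun [set: R] rounding.
Proof.
move=> _ A mA; rewrite setTI.
have -> : rounding @^-1` A = \bigcup_(n : int) (`[n%:~R, n%:~R + 1[ `&`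
    (fun y => n%:~R + spread (levels n) (y - n%:~R)) @^-1` A).
  apply/seteqP; split => y.
    move=> Ay; exists (Num.floor y) => //; split => //=.
    by rewrite in_itv/=; have := frac_itv y; lra.
  case=> n _ [] /=; rewrite in_itv/= => yn.
  by rewrite /rounding (@floor_def _ _ n)// intrD1.
apply: countable_bigcupT_measurable => [|n]; first exact: countableP.
apply: measurableI => //; rewrite -[X in measurable X]setTI.
have : measurable_fun [set: R]
    (fun y : R => n%:~R + spread (levels n) (y - n%:~R)).
  apply: measurable_funD; first exact: measurable_cst.
  apply: (measurableT_comp (measurable_spread _)).
  by apply: measurable_funB => //; exact: measurable_cst.
exact.
Qed.

End rounding.

(** * Images of Lebesgue measure under maps at bounded distance from identity *)

Lemma compact_itv_bound {R : realType} (K : set R) : compact K ->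
  exists2 M : R, 0 <= M & K `<=` `[- M, M].
Proof.
move=> /compact_bounded[N [_ KN]]; exists (`|N| + 1) => [|x Kx].
  by rewrite addr_ge0.
have := KN (`|N| + 1) _ x Kx; rewrite /= in_itv/= -ler_norml; apply.
by rewrite ltr_pwDr// ler_norm.
Qed.

Section image_lebesgue.
Context {R : realType}.
Local Notation leb := (@lebesgue_measure R).

Definition image_lebesgue (T : R -> R) (mT : measurable_fun [set: R] T) :
    {measure set R -> \bar R} :=
  @measure_function_pushforward__canonical__measure_function_Measure _ _
    (measurableTypeR R) R R leb T mT.

Variables (T : R -> R) (mT : measurable_fun [set: R] T).
Hypothesis nearT : forall y, `|T y - y| <= 1.
Local Notation mu := (image_lebesgue T mT).

Lemma image_lebesgueE A : mu A = leb (T @^-1` A).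
Proof. by []. Qed.

Lemma measurable_preimage_image (A : set R) :
  measurable A -> measurable (T @^-1` A).
Proof. by move=> mA; rewrite -[X in measurable X]setTI; exact: mT. Qed.

Lemma image_lebesgue_le (A : set R) (a b : R) : a <= b -> measurable A ->
  A `<=` `[a, b] -> (mu A <= (b - a + 2)%:E)%E.
Proof.
move=> ab mA Aab; rewrite image_lebesgueE.
apply: (@le_trans _ _ (leb `[a - 1, b + 1])).
  apply: le_measure; rewrite ?inE//; first exact: measurable_preimage_image.
  move=> y /Aab; have := nearT y; rewrite /= !in_itv/= ler_norml; lra.
rewrite lebesgue_measure_itv/= lte_fin; case: ifP => _; rewrite lee_fin; lra.
Qed.

Lemma radon_image_lebesgue : radon mu.
Proof.
move=> K cK; have [M M0 KM] := compact_itv_bound _ cK.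
apply: (le_lt_trans (image_lebesgue_le K (- M) M _ _ KM)); rewrite ?ltry//.
  lra.
exact: compact_measurable.
Qed.

Lemma nonzero_image_lebesgue : nonzero_measure mu.
Proof.
exists [set: R] => //; rewrite image_lebesgueE preimage_setT.
by rewrite -set_itvNyy lebesgue_measure_itv.
Qed.

(** A positive measure has no cancellation between the pieces of a partition.
    A set without measurable partition has variation [-oo], the supremum of
    the empty set, hence the quantification over the measurable [B]. *)
Lemma measure_variation_le (nu : {measure set R -> \bar R}) (A : set R)
    (x : \bar R) :
  (forall B, measurable B -> B = A -> nu B <= x)%E ->
  (measure_variation nu A <= x)%E.
Proof.
move=> nuA; apply: ge_ereal_sup => _ [n [F [mF tF UF ->]]].
under eq_bigr do rewrite gee0_abs//.
have UE : \bigcup_i F i = \big[setU/set0]_(i < n) F i.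
  by rewrite -(bigcup_pred xpredT); congr bigcup; apply/seteqP; split.
have mU : measurable (\big[setU/set0]_(i < n) F i).
  by apply: bigsetU_measurable => i _; exact: mF.
rewrite -measure_semi_additive_ord//.
by apply: nuA => //; rewrite -UE.
Qed.

Lemma translation_bounded_image_lebesgue : translation_bounded mu.
Proof.
move=> K cK; have [M M0 KM] := compact_itv_bound _ cK.
apply: (@le_lt_trans _ _ (2 * M + 2)%:E); last exact: ltry.
apply: ge_ereal_sup => _ [t _ <-].
apply: measure_variation_le => B mB BE.
apply: (le_trans (image_lebesgue_le B (t - M) (t + M) _ mB _)).
- lra.
- by rewrite BE => _ [x /KM + <-]; rewrite /= !in_itv/=; lra.
- by rewrite lee_fin; lra.
Qed.

(** Around a point [x] of the support, a bounded ball contains finitely many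
    values of [T]; removing those other than [x] leaves an open set [V] in which
    [T] takes no other value than [x], and the points of [V] other than [x] are outside
    the support. *)
Lemma discrete_image_lebesgue :
  (forall M, finite_set (T @` `[- M, M])) -> discrete_measure mu.
Proof.
have accR : accessible_space R.
  by apply: hausdorff_accessible; exact: Rhausdorff.
move=> finT x sx; split; first exact/mem_set.
pose F := T @` `[- (`|x| + 2), `|x| + 2] `\ x.
have finF : finite_set F by apply: finite_setD; exact: finT.
have clF : closed F.
  exact: accessible_finite_set_closed.1 accR _ finF.
pose V := ball x 1 `\` F.
have oV : open V.
  rewrite /V setDE.
  by apply: openI; [exact: ball_open | exact: closed_openC].
have Vx : V x by split; [exact: ballxx | move=> [_]; exact].
have VT y : V (T y) -> T y = x.
  rewrite /V /ball/= => -[xTy]; apply: contra_notP => Tyx; split => //.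
  exists y => //; rewrite /= in_itv/=; have := nearT y.
  have := ler_norm x; have := ler_norm (- x); rewrite normrN.
  by move: xTy; rewrite ltr_norml ler_norml; lra.
exists V; first exact: open_nbhs_nbhs.
apply/seteqP; split => [y [Vy sy]|y ->]; last by split.
apply: contrapT => /= yx; suff : (0 < mu (V `\ x))%E.
  rewrite image_lebesgueE (_ : _ @^-1` _ = set0) ?measure0 ?ltxx//.
  by apply/seteqP; split => // z [/VT].
apply: sy; split => //; rewrite setDE; apply: openI => //; apply: closed_openC.
exact: accessible_finite_set_closed.1 accR _ (finite_set1 x).
Qed.

Lemma image_lebesgue_atom (x e : R) : 0 <= e ->
  (forall y y', T y = x -> T y' = x -> `|y - y'| <= e) ->
  (mu [set x] <= (2 * e)%:E)%E.
Proof.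
move=> e0 fib; rewrite image_lebesgueE.
have [[y Tyx]|noy] := pselect (exists y, T y = x); last first.
  rewrite (_ : _ @^-1` _ = set0) ?measure0 ?lee_fin; first by lra.
  by apply/seteqP; split => // y Ty; apply: noy; exists y.
apply: (@le_trans _ _ (leb `[y - e, y + e])).
  apply: le_measure; rewrite ?inE//; first exact: measurable_preimage_image.
  by move=> z /(fib y z Tyx); rewrite /= in_itv/= ler_norml; lra.
by rewrite lebesgue_measure_itv/= lte_fin; case: ifP => _; rewrite lee_fin; lra.
Qed.

End image_lebesgue.

(** * Convolutions with an image of Lebesgue measure *)

Section integrals.
Context {R : realType}.
Local Notation leb := (@lebesgue_measure R).
Implicit Types (h : R -> R).

Lemma norm_Rintegral_le (phi : R -> R) (a b e : R) : a <= b -> 0 <= e ->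
  measurable_fun [set: R] phi -> (forall y, `|phi y| <= e) ->
  (forall y, y \notin `[a, b] -> phi y = 0) ->
  leb.-integrable [set: R] (EFin \o phi) /\
  `|\int[leb]_y phi y| <= e * (b - a).
Proof.
move=> ab e0 mphi phie phi0.
have lebab : leb (`[a, b]%classic : set (measurableTypeR R)) = (b - a)%:E.
  rewrite lebesgue_measure_itv/= lte_fin; case: ifPn => //.
  rewrite -leNgt => ba.
  by have -> : b = a by [lra]; rewrite subrr.
have mD : measurable (`[a, b]%classic : set (measurableTypeR R)).
  exact: measurable_itv.
have iab (f : R -> R) : measurable_fun [set: R] f -> (forall y, `|f y| <= e) ->
    leb.-integrable `[a, b] (EFin \o f).
  move=> mf fe; apply: measurable_bounded_integrable => //.
  - by rewrite /= lebab ltry.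
  - exact: measurable_funS mf.
  exists e; split; first exact: num_real.
  by move=> M eM y _ /=; apply: (le_trans (fe y)); exact: ltW.
have phiE : phi \_ `[a, b] = phi.
  apply/funext => y; rewrite patchE; case: ifPn => //.
  by rewrite notin_setE => yab; rewrite phi0//; apply/negP.
split.
  have -> : EFin \o phi = (EFin \o phi) \_ `[a, b].
    by rewrite restrict_EFin phiE.
  exact: ((integrable_mkcond _ mD).1 (iab _ mphi phie)).
rewrite -[X in Rintegral _ _ X]phiE -Rintegral_mkcond.
apply: (le_trans (le_normr_Rintegral mD (iab _ mphi phie))).
apply: (@le_trans _ _ (\int[leb]_(y in `[a, b]) cst e y)).
  apply: le_Rintegral => //.
  - by apply: iab => [|y]; [exact: measurableT_comp | rewrite normr_id].
  - by apply: iab => [|y]; [exact: measurable_cst | rewrite ger0_norm].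
by rewrite Rintegral_cst//= lebab.
Qed.

Lemma measurable_shift (p : R) :
  measurable_fun [set: measurableTypeR R] (fun y => y + p : measurableTypeR R).
Proof. by apply: measurable_funD => //; exact: measurable_cst. Qed.

Lemma lebesgue_measureD (p : R) (A : set R) : measurable A ->
  pushforward leb (fun y => y + p : measurableTypeR R) A = leb A.
Proof.
move=> mA; apply/esym/lebesgue_measure_unique => //=.
  exact: measurable_shift.
move=> mp _ [[a b] _ <-]; rewrite /pushforward.
have -> : (fun y => y + p) @^-1` `]a, b] = `]a - p, b - p]%classic.
  by apply/seteqP; split => y; rewrite /= !in_itv/=; lra.
rewrite !lebesgue_measure_itv/= !lte_fin ltrD2r.
by case: ifP => // _; congr (_%:E); lra.
Qed.

Lemma Rintegral_shift (phi : R -> R) (p : R) :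
  measurable_fun [set: R] phi ->
  leb.-integrable [set: R] (EFin \o (fun y => phi (y + p))) ->
  \int[leb]_y phi (y + p) = \int[leb]_y phi y.
Proof.
move=> mphi iphi; rewrite /Rintegral; congr fine.
transitivity (\int[pushforward leb (fun y => (y + p)%R : measurableTypeR R)]_y
    (phi y)%:E)%E.
  rewrite integral_pushforward//; first exact: measurable_shift.
  exact/measurable_EFinP.
apply: eq_measure_integral; first exact: measurable_shift.
move=> mp A mA _; exact: lebesgue_measureD.
Qed.

(** Heine's theorem; the support is enlarged by 1 so that of two points at
    distance at most 1, both lie in the compact set or [h] is 0 at both. *)
Lemma continuous_supported_unif h (M : R) : continuous h ->
  (forall x, M < `|x| -> h x = 0) ->
  (exists B, forall x, `|h x| <= B) /\
  forall e, 0 < e -> exists2 d, 0 < d &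
    forall x x', `|x - x'| <= d -> `|h x - h x'| <= e.
Proof.
move=> ch h0.
have cK (N : R) : compact `[- N, N] by exact: segment_compact.
split.
  have := continuous_compact (continuous_subspaceT ch) (cK M).
  move=> /(@compact_bounded _ R)[N [_ hN]]; exists (`|N| + 1) => x.
  have [Mx|xM] := ltP M `|x|; first by rewrite h0// normr0 addr_ge0.
  apply: (hN (`|N| + 1)); first by rewrite ltr_pwDr// ler_norm.
  by exists x => //; rewrite /= in_itv/= -ler_norml.
move=> e e0.
pose P d x := forall x', `|x - x'| <= d -> `|h x - h x'| <= e.
(* A radius that works near each point of a compact set can be chosen
   uniformly. *)
have cov : \forall d \near (0 : R)^'+, `[- (M + 1), M + 1] `<=` P d.
  apply: ((compact_near_coveringP _).1 (cK (M + 1))) => x _.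
  have e20 : 0 < e / 2 by rewrite divr_gt0.
  have := (cvgrPdist_lt _ _).1 (ch x) _ e20.
  rewrite -nbhs_ballE => -[r /= r0 rP].
  have r20 : 0 < r / 2 by rewrite divr_gt0.
  exists (ball x (r / 2), [set d | d < r / 2]) => /=.
    split; first exact: nbhsx_ballx.
    exact: nbhs_right_lt.
  move=> [z d] [/= xz dr] x' zx'; rewrite /ball/= in xz rP.
  have h1 : `|h x - h z| < e / 2 by apply: rP => /=; lra.
  have h2 : `|h x - h x'| < e / 2.
    by apply: rP => /=; have := ler_distD z x x'; lra.
  by have := ler_distD (h x) (h z) (h x'); rewrite (distrC (h z) (h x)); lra.
near (0 : R)^'+ => d; exists d => // x x' xx'.
have [xM|Mx] := leP `|x| (M + 1).
  have : `[- (M + 1), M + 1] `<=` P d by near: d.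
  by move=> /(_ x); apply => //; rewrite /= in_itv/= -ler_norml.
have d1 : d <= 1 by near: d; exact: nbhs_right_le.
have := ler_distD x' x 0; rewrite !subr0 => xx0.
by rewrite !h0 ?subrr ?normr0 ?ltW//; lra.
Unshelve. all: end_near. Qed.

End integrals.

Section convolution.
Context {R : realType}.
Local Notation leb := (@lebesgue_measure R).
Variables (T : R -> R) (mT : measurable_fun [set: R] T).
Hypothesis nearT : forall y, `|T y - y| <= 1.
Local Notation mu := (image_lebesgue T mT).

(** As functions of the Lebesgue variable [y], the two integrands are
    [h (x + p + s - T y)] and [h (x - T y)].  Replacing [y] by [y + p] in the
    first one, which does not change its integral, brings the arguments within
    [`|s| + `|T (y + p) - (T y + p)|] of each other; and both integrands vanish
    outside an interval of length [2 * M + 4]. *)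
Lemma convolution_almost_period (h : R -> R) (M B d e p s x : R) :
  continuous h -> 0 <= M -> (forall z, `|h z| <= B) ->
  (forall z, M < `|z| -> h z = 0) ->
  0 <= e -> (forall z z', `|z - z'| <= d -> `|h z - h z'| <= e) ->
  (forall y, `|T (y + p) - (T y + p)| <= d / 2) -> `|s| <= d / 2 -> `|s| <= 1 ->
  `|\int[mu]_y h (x + p + s - y) - \int[mu]_y h (x - y)| <= e * (2 * M + 4).
Proof.
move=> ch M0 hB h0 e0 hd Tp sd s1.
have mh : measurable_fun [set: R] h by exact: continuous_measurable_fun.
have mhB a : measurable_fun [set: R] (fun y => h (a - y)).
  apply: (measurableT_comp mh).
  by apply: measurable_funB => //; exact: measurable_cst.
have mhT a : measurable_fun [set: R] (fun y => h (a - T y)).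
  exact: (measurableT_comp (mhB a) mT).
have B0 : 0 <= B by apply: le_trans (hB 0).
pose phi1 y := h (x + p + s - T (y + p)).
pose phi2 y := h (x - T y).
have m1 : measurable_fun [set: R] phi1.
  exact: (measurableT_comp (mhT (x + p + s)) (measurable_shift p)).
have out1 y : y \notin `[x - (M + 2), x + (M + 2)] -> phi1 y = 0.
  move=> yx; apply: h0; apply: contraNT yx; rewrite -leNgt in_itv/=.
  by have := nearT (y + p); rewrite !ler_norml in s1 *; lra.
have out2 y : y \notin `[x - (M + 2), x + (M + 2)] -> phi2 y = 0.
  move=> yx; apply: h0; apply: contraNT yx; rewrite -leNgt in_itv/=.
  by have := nearT y; rewrite !ler_norml; lra.
have ab : x - (M + 2) <= x + (M + 2) by lra.
have [i1 _] := norm_Rintegral_le _ _ _ _ ab B0 m1 (fun y => hB _) out1.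
have [i2 _] := norm_Rintegral_le _ _ _ _ ab B0 (mhT x) (fun y => hB _) out2.
have convE a : leb.-integrable [set: R] (EFin \o (fun y => h (a - T y))) ->
    \int[mu]_y h (a - y) = \int[leb]_y h (a - T y).
  move=> ia; rewrite /Rintegral; congr fine.
  by rewrite integral_pushforward//; exact/measurable_EFinP.
have iT a : leb.-integrable [set: R] (EFin \o (fun y => h (a - T y))).
  have aa : a - (M + 2) <= a + (M + 2) by lra.
  apply: (norm_Rintegral_le _ _ _ _ aa B0 (mhT a) (fun y => hB _) _).1 => y.
  move=> ya; apply: h0; apply: contraNT ya; rewrite -leNgt in_itv/=.
  by have := nearT y; rewrite !ler_norml; lra.
rewrite !convE// -(Rintegral_shift _ p (mhT _) i1) -RintegralB//.
have -> : e * (2 * M + 4) = e * (x + (M + 2) - (x - (M + 2))) by lra.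
apply: (norm_Rintegral_le (fun y => phi1 y - phi2 y) _ _ _ ab e0 _ _ _).2.
- by apply: measurable_funB; [exact: m1|exact: mhT].
- move=> y; apply: hd.
  by have := Tp y; rewrite !ler_norml in sd *; lra.
- by move=> y yx; rewrite out1// out2// subrr.
Qed.
End convolution.

(** * Almost periods and compactness of the translates *)

Section bohr.
Context {R : realType}.
Local Open Scope complex_scope.
Implicit Types (g l : R -> R[i]) (e d L : R).

(** A form of Bohr's criterion that suits limit periodic functions: the almost
    periods are the neighbourhoods of all multiples of some [L].  Including a
    neighbourhood of 0 makes uniform continuity part of the criterion. *)
Definition bohr g := forall e, 0 < e -> exists L d, [/\ 0 < L, 0 < d &
  forall (m : int) s x, `|s| <= d -> `|g (x + m%:~R * L + s) - g x| <= e%:C].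

(** Modulo [L], the line is covered by finitely many intervals of radius
    [d]. *)
Lemma finite_net L d : 0 < L -> 0 < d -> exists J : nat, forall t,
  exists (m : int) (j : 'I_J) s, `|s| <= d /\ t = m%:~R * L + j%:R * d + s.
Proof.
move=> L0 d0; exists (Num.truncn (L / d)).+1 => t.
pose m := Num.floor (t / L); pose r := t - m%:~R * L.
have r0L : 0 <= r < L.
  have := floor_itv (t / L); rewrite ler_pdivlMr// ltr_pdivrMr// intrD1 -/m /r.
  lra.
have rd0 : 0 <= r / d by rewrite divr_ge0 ?(ltW d0)//; lra.
have jJ : (Num.truncn (r / d) < (Num.truncn (L / d)).+1)%N.
  by rewrite ltnS; apply: le_truncn; rewrite ler_pM2r ?invr_gt0//; lra.
exists m, (Ordinal jJ), (r - (Num.truncn (r / d))%:R * d); split; last first.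
  by rewrite /r/=; lra.
have := truncn_itv rd0; rewrite ler_pdivlMr// ltr_pdivrMr//.
rewrite -natr1 ler_norml; lra.
Qed.

Lemma complex_entourage (E : set (R[i] * R[i])) : entourage E ->
  exists2 e, 0 < e & forall z w, `|z - w| <= e%:C -> E (z, w).
Proof.
rewrite -entourage_ballE => -[/= [a b]]; rewrite ltcE/= => /andP[/eqP-> a0] aE.
exists (a / 2); first by rewrite divr_gt0.
move=> z w zw; apply: aE => /=; apply: (le_lt_trans zw).
by rewrite ltcR; lra.
Qed.

Lemma entourage_complex e : 0 < e ->
  entourage [set zw : R[i] * R[i] | `|zw.1 - zw.2| <= e%:C].
Proof.
move=> e0; rewrite -entourage_ballE; exists e%:C; first by rewrite /= ltcR.
by move=> [z w] /= /ltW.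
Qed.

Lemma bohr_unif_continuous g : bohr g -> unif_continuous g.
Proof.
move=> bg E /complex_entourage[e e0 eE].
have [L [d [_ d0 gd]]] := bg e e0.
rewrite /= -entourage_ballE; exists d => //= -[x y] /= xy.
apply: eE; have := gd 0 (x - y) y; rewrite mul0r addr0 (addrC y) subrK; apply.
exact: ltW.
Qed.

Lemma bohr_bounded g : bohr g -> bounded_fun g.
Proof.
move=> bg; have [L [d [L0 d0 gd]]] := bg 1 ltr01.
have [J JP] := finite_net L d L0 d0.
exists (1 + \sum_(j < J) `|g (j%:R * d)|); split.
  by rewrite realD// ?real1// sum_real// => j _; exact: normr_real.
move=> M gM x _ /=; apply: le_trans (ltW gM).
have [m [j [s [sd ->]]]] := JP x.
have := gd m s (j%:R * d) sd.
rewrite (addrC (j%:R * d)) => h.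
rewrite -[g _](subrK (g (j%:R * d))); apply: (le_trans (ler_normD _ _)).
apply: lerD => //.
by rewrite (bigD1 j)//= lerDl sumr_ge0.
Qed.

Lemma bohr_Cu g : bohr g -> Cu g.
Proof.
by move=> bg; split; [exact: bohr_unif_continuous | exact: bohr_bounded].
Qed.

Lemma closure_translates g (f : {uniform R -> R[i]}) e : 0 < e ->
  closure (translates g) f ->
  exists t, forall x, `|f x - g (x - t)| <= e%:C.
Proof.
move=> e0 /(_ [set h | forall x, `|f x - h x| <= e%:C])[].
  apply/uniform_nbhs; exists [set zw | `|zw.1 - zw.2| <= e%:C].
  by split; [exact: entourage_complex | move=> h + x; exact].
by move=> _ [[t _ <-] ft]; exists t.
Qed.

Lemma closure_translates_bohr g (f : {uniform R -> R[i]}) : bohr g ->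
  closure (translates g) f -> bohr f.
Proof.
move=> bg gf e e0; have e30 : 0 < e / 3 by rewrite divr_gt0.
have [L [d [L0 d0 gd]]] := bg _ e30; exists L, d; split => // m s x sd.
have [t ft] := closure_translates _ _ _ e30 gf.
have := gd m s (x - t) sd; have := ft x; have := ft (x + m%:~R * L + s).
rewrite (_ : x + _ + s - t = x - t + m%:~R * L + s); last by lra.
move=> h1; rewrite distrC => h2 h3.
have -> : e%:C = (e / 3)%:C + (e / 3)%:C + (e / 3)%:C.
  by rewrite -!rmorphD/=; congr (_%:C); lra.
rewrite -(subrKA (g (x - t + m%:~R * L + s))).
rewrite -[X in `|_ + X|](subrKA (g (x - t))).
rewrite addrA; apply: (le_trans (ler_normD _ _)); apply: lerD => //.
by apply: (le_trans (ler_normD _ _)); apply: lerD.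
Qed.

Lemma complex_norm_le (z : R[i]) (a b : R) :
  `|complex.Re z| <= a -> `|complex.Im z| <= b -> `|z| <= (a + b)%:C.
Proof.
move=> za zb; rewrite normc_def lecR.
have a0 : 0 <= a by apply: le_trans za.
have b0 : 0 <= b by apply: le_trans zb.
rewrite -[leRHS]ger0_norm ?addr_ge0// -sqrtr_sqr ler_wsqrtr//.
have := ler_pM (normr_ge0 _) (normr_ge0 _) za za.
have := ler_pM (normr_ge0 _) (normr_ge0 _) zb zb.
rewrite -!expr2 !real_normK ?num_real// => h1 h2.
by have := mulr_ge0 a0 b0; nra.
Qed.

Lemma Re_norm_le (z : R[i]) e : `|z| <= e%:C -> `|complex.Re z| <= e.
Proof.
rewrite normc_def !lecR; apply: le_trans.
by rewrite -sqrtr_sqr ler_wsqrtr// lerDl sqr_ge0.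
Qed.

Lemma Im_norm_le (z : R[i]) e : `|z| <= e%:C -> `|complex.Im z| <= e.
Proof.
rewrite normc_def !lecR; apply: le_trans.
by rewrite -sqrtr_sqr ler_wsqrtr// lerDr sqr_ge0.
Qed.

Lemma ultra_cover {T : Type} (F : set_system T) (J : nat) (B : 'I_J -> set T)
    (A : set T) :
  UltraFilter F -> F A -> (forall x, A x -> exists j, B j x) ->
  exists j, F (B j).
Proof.
move=> UF FA AB; apply: contrapT => noB.
have FC j : F (~` B j).
  by have [FB|//] := in_ultra_setVsetC (B j) UF; case: noB; exists j.
have := filter_ex (filterI FA (filter_forall _ FC)).
by case=> x [/AB[j Bjx]] /(_ j); exact.
Qed.

(** The bound on [`|a - phi f|] depends on [P] and [e] only; with [phi] the
    evaluation at a point, it makes the convergence uniform in that point. *)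
Lemma limit_of_small {T : Type} (F : set_system T) (FF : ProperFilter F)
    (phi : T -> R) :
  (forall e, 0 < e -> exists2 P, F P &
     forall f f', P f -> P f' -> `|phi f - phi f'| <= e) ->
  exists a, forall e P, 0 < e -> F P ->
    (forall f f', P f -> P f' -> `|phi f - phi f'| <= e) ->
    forall f, P f -> `|a - phi f| <= 2 * e.
Proof.
move=> small.
have cF : cvg (phi f @[f --> F]).
  apply: cauchy_cvg; apply: cauchy_exP => e e0.
  have e20 : 0 < e / 2 by rewrite divr_gt0.
  have [P FP Pe] := small _ e20.
  have [f Pf] := filter_ex FP.
  exists (phi f); have : F [set f' | ball (phi f) e (phi f')]; last exact.
  apply: filterS FP => f' Pf'; rewrite /= /ball/=.
  by have := Pe _ _ Pf Pf'; lra.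
exists (lim (phi f @[f --> F])) => e P e0 FP Pe f Pf.
have lime : F [set f' | `|lim (phi f @[f --> F]) - phi f'| <= e].
  exact: (cvgrPdist_le _ _).1 cF _ e0.
have [f' [Pf' f'e]] := filter_ex (filterI FP lime).
rewrite /= in f'e; have := Pe _ _ Pf' Pf.
by have := ler_distD (phi f') (lim (phi f @[f --> F])) (phi f); lra.
Qed.

(** Total boundedness of the translates, seen by an ultrafilter: up to almost
    periods, every translate is one of finitely many. *)
Lemma bohr_ultra_small g (F : set_system {uniform R -> R[i]}) e :
  bohr g -> UltraFilter F -> F (closure (translates g)) -> 0 < e ->
  exists2 P, F P & forall f f' : R -> R[i], P f -> P f' ->
    forall x, `|f x - f' x| <= e%:C.
Proof.
move=> bg UF FA e0; have e40 : 0 < e / 4 by rewrite divr_gt0.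
have [L [d [L0 d0 gd]]] := bg _ e40.
have [J JP] := finite_net L d L0 d0.
pose B (j : 'I_J) : set {uniform R -> R[i]} :=
  [set f | forall x, `|f x - g (x - j%:R * d)| <= (e / 2)%:C].
have [f gf|j FB] := ultra_cover F J B _ UF FA.
  have [t ft] := closure_translates _ _ _ e40 gf.
  have [m [j [s [sd tE]]]] := JP t; exists j => x.
  have -> : (e / 2)%:C = (e / 4)%:C + (e / 4)%:C :> R[i].
    by rewrite -!rmorphD/=; congr (_%:C); lra.
  rewrite -(subrKA (g (x - t))); apply: (le_trans (ler_normD _ _)).
  apply: lerD => //; have := gd m s (x - t) sd; rewrite distrC.
  by have -> : x - t + m%:~R * L + s = x - j%:R * d by rewrite tE; lra.
exists (B j) => // f f' Bf Bf' x.
have -> : e%:C = (e / 2)%:C + (e / 2)%:C :> R[i].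
  by rewrite -!rmorphD/=; congr (_%:C); lra.
rewrite -(subrKA (g (x - j%:R * d))).
apply: (le_trans (ler_normD _ _)).
by apply: lerD; [exact: Bf | rewrite distrC; exact: Bf'].
Qed.

(** Compactness by ultrafilters.  An ultrafilter on the closure contains sets
    of arbitrarily small uniform diameter, so it converges at each point, and
    uniformly.  The limit inherits the almost periods of [g], which places it
    in [Cu]. *)
Lemma bohr_almost_periodic g : bohr g -> almost_periodic g.
Proof.
move=> bg; split; first exact: bohr_Cu.
rewrite compact_ultra => F UF FA.
have FG : F (closure (translates g)) by apply: filterS FA => f [].
have small e (e0 : 0 < e) := bohr_ultra_small g F e bg UF FG e0.
have Rex x : exists a, forall e P, 0 < e -> F P ->
    (forall f f' : R -> R[i], P f -> P f' ->
       `|complex.Re (f x) - complex.Re (f' x)| <= e) ->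
    forall f : R -> R[i], P f -> `|a - complex.Re (f x)| <= 2 * e.
  apply: (limit_of_small F _ (fun f : R -> R[i] => complex.Re (f x))) => e e0.
  have [P FP Pe] := small e e0; exists P => // f f' Pf Pf'.
  by rewrite -raddfB; exact/Re_norm_le/Pe.
have Imx x : exists a, forall e P, 0 < e -> F P ->
    (forall f f' : R -> R[i], P f -> P f' ->
       `|complex.Im (f x) - complex.Im (f' x)| <= e) ->
    forall f : R -> R[i], P f -> `|a - complex.Im (f x)| <= 2 * e.
  apply: (limit_of_small F _ (fun f : R -> R[i] => complex.Im (f x))) => e e0.
  have [P FP Pe] := small e e0; exists P => // f f' Pf Pf'.
  by rewrite -raddfB; exact/Im_norm_le/Pe.
have [a aP] := choice Rex; have [b bP] := choice Imx.
pose l : {uniform R -> R[i]} := fun x => a x +i* b x.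
have Fl : F --> l.
  move=> N /uniform_nbhs[E [/complex_entourage[e e0 eE] EN]].
  have e40 : 0 < e / 4 by rewrite divr_gt0.
  have [P FP Pe] := small _ e40.
  apply: (filterS _ FP) => f Pf; apply: EN => x _; apply: eE.
  have -> : e = 2 * (e / 4) + 2 * (e / 4) by lra.
  apply: complex_norm_le; rewrite raddfB/=.
    apply: (aP x _ P e40 FP) => // f1 f2 Pf1 Pf2.
    by rewrite -raddfB; exact/Re_norm_le/Pe.
  apply: (bP x _ P e40 FP) => // f1 f2 Pf1 Pf2.
  by rewrite -raddfB; exact/Im_norm_le/Pe.
have gl : closure (translates g) l.
  rewrite ((closure_id (closure (translates g))).1 (@closed_closure _ _)).
  move=> N /Fl FN; exact: filter_ex (filterI FG FN).
exists l; split => //; split => //.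
exact/bohr_Cu/(closure_translates_bohr g).
Qed.

End bohr.

(** * Almost periodicity of the image measures *)

Section bohr_convolution.
Context {R : realType}.
Local Open Scope complex_scope.

Lemma continuous_Re_Im (f : R -> R[i]) : continuous f ->
  continuous (fun x => complex.Re (f x)) /\
  continuous (fun x => complex.Im (f x)).
Proof.
have dist x : {for x, continuous f} -> forall e : R, 0 < e ->
    \forall z \near x, `|f x - f z| <= e%:C.
  by move=> cf e e0; apply: (cvgrPdist_le _ _).1 cf _ _; rewrite ltcR.
move=> cf; split=> x; apply/cvgrPdist_le => e e0;
    apply: filterS (dist x (cf x) e e0) => z; rewrite -raddfB.
  exact: Re_norm_le.
exact: Im_norm_le.
Qed.

Lemma bohr_convolution (T : R -> R) (mT : measurable_fun [set: R] T)
    (f : R -> R[i]) : (forall y, `|T y - y| <= 1) ->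
  (forall d, 0 < d -> exists2 L, 0 < L & forall (m : int) y,
     `|T (y + m%:~R * L) - (T y + m%:~R * L)| <= d) ->
  Cc f -> bohr (convolution f (image_lebesgue T mT)).
Proof.
move=> nearT quasiT [cf cK] e e0.
have [M M0 KM] := compact_itv_bound _ cK.
have f0 x : M < `|x| -> f x = 0.
  move=> Mx; apply/eqP; apply: contraTT Mx => fx; rewrite -leNgt ler_norml.
  by have := KM x (@subset_closure _ _ x fx); rewrite /= in_itv.
have [cRe cIm] := continuous_Re_Im f cf.
have Re0 x : M < `|x| -> complex.Re (f x) = 0 by move/f0 ->.
have Im0 x : M < `|x| -> complex.Im (f x) = 0 by move/f0 ->.
have [[B1 hB1] /(_ (e / (2 * (2 * M + 4))))[|d1 d10 hd1]] :=
  continuous_supported_unif _ _ cRe Re0.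
  by apply: divr_gt0 => //; lra.
have [[B2 hB2] /(_ (e / (2 * (2 * M + 4))))[|d2 d20 hd2]] :=
  continuous_supported_unif _ _ cIm Im0.
  by apply: divr_gt0 => //; lra.
pose d := Num.min d1 d2.
have d0 : 0 < d by rewrite lt_min d10.
have [dd1 dd2] : d <= d1 /\ d <= d2 by rewrite !ge_min !lexx orbT.
have [L L0 LT] := quasiT _ (divr_gt0 d0 (ltr0n _ 2)).
exists L, (Num.min (d / 2) 1); split => //.
  by rewrite lt_min ltr01 divr_gt0.
move=> m s x; rewrite le_min => /andP[sd s1].
have eE : e / (2 * (2 * M + 4)) * (2 * M + 4) = e / 2.
  by field; apply: lt0r_neq0; lra.
have -> : e = e / (2 * (2 * M + 4)) * (2 * M + 4) +
              e / (2 * (2 * M + 4)) * (2 * M + 4).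
  by rewrite eE; lra.
have e1 : 0 <= e / (2 * (2 * M + 4)) by apply: divr_ge0; lra.
apply: complex_norm_le; rewrite raddfB/=.
  apply: (convolution_almost_period _ mT nearT
    (fun x => complex.Re (f x)) M B1 d) => //.
  by move=> z z' zz'; apply: hd1; exact: le_trans dd1.
apply: (convolution_almost_period _ mT nearT
    (fun x => complex.Im (f x)) M B2 d) => //.
by move=> z z' zz'; apply: hd2; exact: le_trans dd2.
Qed.

Lemma exists_half_power (e : R) : 0 < e -> exists K, 2 ^- K <= e.
Proof.
move=> e0; exists (Num.truncn e^-1).+1.
rewrite invf_ple ?posrE ?exprn_gt0//; apply: (le_trans (ltW (truncnS_gt _))).
by rewrite -natrX ler_nat ltnW// ltn_expl.
Qed.

End bohr_convolution.

(** * The measure *)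

Theorem theorem4 (R : realType) :
  exists mu : {measure set R -> \bar R},
    [/\ radon mu, nonzero_measure mu, discrete_measure mu,
        translation_bounded mu & almost_periodic_measure mu] /\
    (forall eps : R, 0 < eps ->
       exists2 r : R, 0 < r &
         forall x : R, x \in msupport mu -> r < `|x| ->
           (mu [set x] < eps%:E)%E).
Proof.
exists (image_lebesgue rounding measurable_rounding); split.
  split.
  - exact/radon_image_lebesgue/rounding_near.
  - exact: nonzero_image_lebesgue.
  - apply: discrete_image_lebesgue; first exact: rounding_near.
    exact: rounding_finite.
  - exact/translation_bounded_image_lebesgue/rounding_near.
  - move=> f Ccf; apply/bohr_almost_periodic/bohr_convolution => //.
      exact: rounding_near.
    move=> d /exists_half_power[K Kd]; exists (2 ^+ K); first exact: exprn_gt0.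
    by move=> m y; apply: le_trans (rounding_quasiperiodic K m y) Kd.
move=> e e0; have e30 : 0 < e / 3 by apply: divr_gt0.
have [N Ne] := exists_half_power _ e30.
(* One more than the bound of [rounding_inj], as the floor of [x] may be closer
   to 0 than [x] by up to 1. *)
exists (2 * N + 9)%:R; first by rewrite ltr0n addn_gt0 orbT.
move=> x _ Nx; apply: (@le_lt_trans _ _ (2 * (2 ^- N))%:E); last first.
  by rewrite lte_fin; lra.
apply: image_lebesgue_atom => [|y y' yx y'x].
  by rewrite invr_ge0 exprn_ge0.
apply: rounding_inj; last by rewrite yx.
rewrite -floor_rounding yx.
have := floor_itv x; rewrite intrD1 => fx.
rewrite -(ler_nat R) natr_absz intr_norm.
have xf : `|x| <= `|(Num.floor x)%:~R| + 1.
  have := ler_norm ((Num.floor x)%:~R : R).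
  have := ler_norm (- (Num.floor x)%:~R : R).
  by rewrite normrN => h1 h2; rewrite ler_norml; lra.
by move: Nx; rewrite (addnS _ 8) -natr1; lra.
Qed.
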